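(* Let $n\ge 2$. For $\omega\in\mathfrak{B}_n$ selected uniformly at random, with $\alpha=\alpha(\omega)$ and $\beta=\beta(\omega)$, the expectations and variances are $$\mathbb{E}[\alpha]=\mathbb{E}[\beta]=\frac{(n+3)(n+2)(n+1)}{60}=\frac{\mathfrak{b}_{n+2}}{10}$$ and $$\mathrm{Var}[\alpha]=\mathrm{Var}[\beta]=\frac{(n+3)(n+2)^2(n+1)^2(n-2)}{2400}=\frac{3(n-2)\,\mathbb{E}[\alpha]^2}{2(n+3)}.$$
   Context: $\mathfrak{S}_n$ is the set of permutations of $[n]=\{1,\dots,n\}$, in one-line notation. A reduction of $\omega\in\mathfrak{S}_n$ interchanges $\omega(i)$ and $\omega(j)$ for some $i<j$ with $\omega(i)>\omega(j)$. Bruhat order: $\pi\le\sigma$ if $\pi$ is obtained from $\sigma$ by a (possibly empty) sequence of reductions. $\mathfrak{B}_n\subseteq\mathfrak{S}_n$ is the set of bigrassmannian permutations, i.e. those $\omega$ such that both $\omega$ and $\omega^{-1}$ have exactly one descent; equivalently $\omega=1\cdots a\,(b+1)\cdots c\,(a+1)\cdots b\,(c+1)\cdots n$ for some $0\le a<b<c\le n$. $\mathfrak{b}_n=|\mathfrak{B}_n|=\binom{n+1}{3}$. For $\omega\in\mathfrak{B}_n$, $\beta(\omega)$ is the number of $\pi\in\mathfrak{B}_n$ with $\pi\le\omega$, and $\alpha(\omega)$ is the number of $\tau\in\mathfrak{B}_n$ with $\omega\le\tau$. *)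

(* Defs.v *)
From mathcomp Require Import all_boot all_order all_algebra all_fingroup.

Set Implicit Arguments.
Unset Strict Implicit.
Unset Printing Implicit Defensive.

Import GRing.Theory Num.Theory.

(* Permutations of {1, ..., n} are shifted to permutations of {0, ..., n-1}. *)

Section Bruhat.

Variable n : nat.

Implicit Types w p s : {perm 'I_n}.

(* Since (u * v) k = v (u k), tperm i j * w is w with w i and w j exchanged. *)
Definition reduction : rel {perm 'I_n} := fun w p =>
  [exists i : 'I_n, exists j : 'I_n,
    [&& i < j, w j < w i & p == (tperm i j * w)%g]].

Definition bruhat_le : rel {perm 'I_n} := fun p s => connect reduction s p.

Definition descents w : {set 'I_n} :=
  [set i : 'I_n | [exists j : 'I_n, (j == i.+1 :> nat) && (w j < w i)]].

Definition bigrassmannian : {set {perm 'I_n}} :=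
  [set w | (#|descents w| == 1) && (#|descents w^-1%g| == 1)].

Definition bruhat_alpha w : nat := #|[set t in bigrassmannian | bruhat_le w t]|.

Definition bruhat_beta w : nat := #|[set p in bigrassmannian | bruhat_le p w]|.

End Bruhat.

Local Open Scope ring_scope.

Definition uexpectation (T : finType) (A : {set T}) (f : T -> rat) : rat :=
  (\sum_(x in A) f x) / #|A|%:R.

Definition uvariance (T : finType) (A : {set T}) (f : T -> rat) : rat :=
  uexpectation A (fun x => (f x - uexpectation A f) ^+ 2).

(* Main.v *)
Require Import Defs.
From mathcomp Require Import all_boot all_order all_algebra all_fingroup.
From mathcomp Require Import zify ring lra.

(* Bruhat order is the pointwise reverse order on the rank functions
   rank w x y = #{k < x | w k < y}. The rank function of a bigrassmannian
   permutation with descent at d, inverse descent at e and a = rank w d e is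
   min(x, y, a + (x - d)^+ + (y - e)^+), because rank functions are concave away
   from the descents. Hence bigrassmannians of size m + 2 correspond to
   p + q + r + s = m (p = a, q = c - b - 1, r = b - a - 1, s = n - c), and going
   down in Bruhat order means increasing p and s while decreasing q and r. So
   beta = (q + 1)(r + 1)(q + r + 2) / 2, alpha is beta after exchanging (p, s)
   with (q, r), and the moments are polynomial sums over the simplex. *)

Set Implicit Arguments.
Unset Strict Implicit.
Unset Printing Implicit Defensive.

Import GRing.Theory Num.Theory.

(** * Rank functions and the rank criterion for Bruhat order *)

Section Rank.

Variable n : nat.
Implicit Types w p s : {perm 'I_n}.

Definition rank w (x y : nat) := \sum_(k < n | k < x) (w k < y).

Lemma rank0 w y : rank w 0 y = 0.
Proof. by rewrite /rank big_pred0. Qed.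

Lemma rankS w (k : 'I_n) y : rank w k.+1 y = rank w k y + (w k < y).
Proof.
rewrite /rank (bigD1 k) //= addnC; congr (_ + _).
by apply: eq_bigl => i; rewrite -val_eqE /=; lia.
Qed.

Lemma rankV w x y : rank w x y = rank w^-1 y x.
Proof.
rewrite /rank big_mkcond [RHS]big_mkcond (reindex_inj (@perm_inj _ w^-1%g)) /=.
by apply: eq_bigr => i _; rewrite permKV; case: ltnP; case: ltnP.
Qed.

Lemma rank_row_full w y : y <= n -> rank w n y = y.
Proof.
move=> le_yn; rewrite rankV /rank (eq_bigr (fun=> 1)) => [|i _]; last first.
  by rewrite ltn_ord.
by rewrite -(big_ord_widen _ (fun=> 1)) // sum1_card card_ord.
Qed.

Lemma rank_inj w p :
  (forall x y, x <= n -> y <= n -> rank w x y = rank p x y) -> w = p.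
Proof.
move=> eqr; apply/permP => k; apply: val_inj => /=.
have h y : y <= n -> (w k < y) = (p k < y).
  move=> le_yn; have := eqr k.+1 y (ltn_ord k) le_yn.
  rewrite !rankS eqr //; last exact: ltnW.
  by case: (w k < y) (p k < y) => [] []; lia.
have := h (w k).+1 (ltn_ord _); have := h (p k).+1 (ltn_ord _).
by lia.
Qed.

(** The exchange matters only if [i] is among the first [x] positions and [j] is not; then [w i] is
    replaced by the smaller [w j], a gain exactly for [w j < y <= w i]. *)
Lemma rank_tperm w (i j : 'I_n) x y : i < j -> w j < w i ->
  rank (tperm i j * w) x y = rank w x y + ((i < x <= j) && (w j < y <= w i)).
Proof.
move=> lt_ij lt_w; have ne : j != i by rewrite -val_eqE /=; lia.
rewrite /rank !(big_mkcond (fun k : 'I_n => k < x)) /=.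
rewrite (bigD1 i) // [X in _ = X + _](bigD1 i) //=.
rewrite (bigD1 j) // [X in _ = _ + X + _](bigD1 j) //=.
rewrite !permM tpermL tpermR.
rewrite (eq_bigr (fun k : 'I_n => if k < x then w k < y : nat else 0)); last first.
  by move=> k /andP[ki kj]; rewrite permM tpermD // eq_sym.
set S := bigop.body _ _ _.
by case: (ltnP i x); case: (ltnP j x); case: (ltnP (w i) y);
  case: (ltnP (w j) y) => /=; lia.
Qed.

Lemma rank_le_bruhat p s : bruhat_le p s ->
  forall x y, rank s x y <= rank p x y.
Proof.
case/connectP => l; elim: l s => [s _ -> //|v l IHl s /= /andP[red pth] eq_p x y].
apply: leq_trans (IHl v pth eq_p x y).
case/existsP: red => i /existsP[j /and3P[lt_ij lt_s /eqP ->]].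
by rewrite rank_tperm // leq_addr.
Qed.

Lemma rank_band w (x y z : nat) : y <= z ->
  rank w x z = rank w x y + \sum_(k < n | k < x) (y <= w k < z).
Proof.
move=> le_yz; rewrite /rank -big_split /=; apply: eq_bigr => k _.
by case: (ltnP (w k) y) => ?; case: (ltnP (w k) z) => ? //=; lia.
Qed.

(* [i] is the first position where [p] and [s] differ, and [j] the first later
   position with [p i <= s j < s i]. *)
Lemma exists_good_reduction p s :
  (forall x y, rank s x y <= rank p x y) -> p <> s ->
  exists i j : 'I_n, [/\ i < j, s j < s i &
    forall x y, rank (tperm i j * s) x y <= rank p x y].
Proof.
move=> le_sp ne_ps.
have [i0 ne_i0] : exists i, p i != s i.
  apply/existsP; apply: contra_notT ne_ps; rewrite negb_exists => /forallP eq_ps.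
  by apply/permP => k; apply/eqP; rewrite -[_ == _]negbK.
case: (@arg_minnP _ i0 (fun i => p i != s i) val ne_i0) => i ne_i min_i.
have eq_lt (k : 'I_n) : k < i -> p k = s k.
  by move=> lt_ki; apply/eqP; apply: contraTT lt_ki => /min_i /=; lia.
have eq_rank y : rank p i y = rank s i y.
  by apply: eq_bigr => k /eq_lt ->.
(* In row [i.+1] at level [(s i).+1], [s] gains one, so [p] must as well. *)
have lt_i : p i < s i.
  have := le_sp i.+1 (s i).+1; rewrite !rankS eq_rank ltnSn.
  by move: ne_i; rewrite -val_eqE /=; case: (ltnP (p i) (s i).+1) => /=; lia.
(* The position of the value [p i] in [s] is a candidate for [j]: it lies after [i], since [p] and
   [s] agree before [i] and differ at [i]. *)
have Pj0 : (i < s^-1%g (p i)) && (p i <= s (s^-1%g (p i)) < s i).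
  rewrite permKV leqnn lt_i !andbT ltnNge leq_eqVlt; apply/negP => /orP[/eqP/val_inj eq_i|lt_ji].
    by move: ne_i; rewrite -{2}eq_i permKV eqxx.
  have := eq_lt _ lt_ji; rewrite permKV => /perm_inj eq_i.
  by move: lt_ji; rewrite eq_i ltnn.
case: (@arg_minnP _ _ (fun j : 'I_n => (i < j) && (p i <= s j < s i)) val Pj0).
move=> j /and3P[lt_ij le_j lt_j] min_j.
exists i, j; split=> // x y; rewrite rank_tperm //.
have [/andP[/andP[lt_ix le_xj] /andP[lt_jy le_yi]]|_] :=
  boolP ((i < x <= j) && (s j < y <= s i)); last by rewrite addn0.
have le_piy : p i <= y by lia.
(* The extra one is paid in the band of values from [p i] to [y]: position [i] is in it for [p] but
   not for [s], and by minimality of [j] no position strictly between [i] and [x] is in it for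
   [s]. *)
rewrite !(rank_band _ _ le_piy) -addnA leq_add //.
have one : \sum_(k < n | k < x) (k == i) = 1.
  rewrite (bigD1 i) //= eqxx big1 // => k /andP[_ /negbTE ->].
  by [].
rewrite -[X in _ + X]/(1 : nat) -{1}one -big_split /=; apply: leq_sum => k lt_kx.
have [-> | ne_ki] := eqVneq k i; first by lia.
rewrite addn0; case: (ltnP k i) => [/eq_lt -> //|le_ik].
have lt_ik : i < k by move: ne_ki; rewrite -val_eqE /=; lia.
by have := min_j k; rewrite lt_ik /=; lia.
Qed.

(** Induction on the summed gap between the rank functions: a good reduction keeps the rank of [s]
    below that of [p] and shrinks the gap. *)
Lemma bruhat_leP p s :
  reflect (forall x y, rank s x y <= rank p x y) (bruhat_le p s).
Proof.
apply: (iffP idP) => [/rank_le_bruhat //|].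
pose gap v := \sum_(x < n.+1) \sum_(y < n.+1) (rank p x y - rank v x y).
have [d] := ubnP (gap s); elim: d s => // d IHd s /ltnSE le_gap le_sp.
have [<-|/eqP ne_ps] := eqVneq p s; first exact: connect0.
have [i [j [lt_ij lt_s le_s'p]]] := exists_good_reduction le_sp ne_ps.
have red : reduction s (tperm i j * s)%g.
  by apply/existsP; exists i; apply/existsP; exists j; rewrite lt_ij lt_s /=.
apply: connect_trans (connect1 red) (IHd _ _ le_s'p).
apply: leq_trans le_gap; rewrite /gap.
(* The gap drops strictly at the cell [(j, s i)], a corner of the rectangle raised by the
   reduction. *)
rewrite (bigD1 (inord j)) // [X in _ < X](bigD1 (inord j)) //= -addSn.
rewrite leq_add //; last first.
  by apply: leq_sum => x _; apply: leq_sum => y _; rewrite rank_tperm //; lia.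
rewrite (bigD1 (inord (s i))) // [X in _ < X](bigD1 (inord (s i))) //= -addSn.
rewrite leq_add //; last first.
  by apply: leq_sum => y _; rewrite rank_tperm //; lia.
have := le_s'p j (s i); rewrite !inordK ?ltnS ?(ltnW (ltn_ord _)) //.
by rewrite rank_tperm // lt_ij lt_s !leqnn /=; lia.
Qed.

End Rank.

(** * Rank functions of block permutations and classification of bigrassmannians *)

Lemma rank_minn n (w : {perm 'I_n}) x y : rank w x y = rank w (minn x n) (minn y n).
Proof.
apply: eq_big => [k|k _].
  by rewrite leq_min ltn_ord andbT.
by rewrite leq_min ltn_ord andbT.
Qed.

(** The increments of [g] are 0 or 1 and never return to 1 after a 0, so [g] climbs with slope one
    to its final value [g d] and stays there. *)
Lemma concave_steps (g : nat -> nat) (b : nat -> bool) d k :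
  (forall i, i < d -> g i.+1 = g i + b i) ->
  (forall i, i.+1 < d -> b i.+1 -> b i) ->
  k <= d -> g k = minn (g 0 + k) (g d).
Proof.
elim: d k => [|d IHd] k step dec le_k.
  by have -> : k = 0 by [lia]; lia.
have {}IHd j : j <= d -> g j = minn (g 0 + j) (g d).
  by apply: IHd => i lt_i; [apply: step | apply: dec]; lia.
have step_d := step d (leqnn _).
have IH_d := IHd d (leqnn _).
have IH_k : k = d.+1 \/ k <= d /\ g k = minn (g 0 + k) (g d).
  by have [le_kd|] := leqP k d; [right; split=> //; apply: IHd | left; lia].
case b_d: (b d) step_d => step_d; last by case: IH_k => [->|[]]; lia.
have full : g d = g 0 + d.
  case: d => [|d] in step dec IHd b_d {le_k step_d IH_k IH_d} *.
    by rewrite addn0.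
  by have := IHd d (leqnSn d); have := step d; rewrite (dec d) //; lia.
by case: IH_k => [->|[]]; lia.
Qed.

Section Block.

Variable n : nat.

(* In the paper's notation, [x = c - b] and [y = b - a]. *)
Definition block_fun a x y k :=
  if a + x + y <= n then
    if k < a then k else if k < a + x then k + y
    else if k < a + x + y then k - x else k
  else k.

Lemma block_fun_lt a x y k : k < n -> block_fun a x y k < n.
Proof. by rewrite /block_fun; do !case: ifP; lia. Qed.

Lemma block_funK a x y : cancel (block_fun a x y) (block_fun a y x).
Proof.
move=> k; rewrite /block_fun addnAC.
case: (leqP (a + x + y) n) => // le_n.
by case: (ltnP k a) => ?; last case: (ltnP k (a + x)) => ?;
  last case: (ltnP k (a + x + y)) => ?; do !case: ifP; lia.
Qed.

Lemma block_ord_inj a x y :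
  injective (fun k : 'I_n => Ordinal (block_fun_lt a x y (ltn_ord k))).
Proof.
by move=> k l /(congr1 val) /= /(can_inj (@block_funK a x y)) /val_inj.
Qed.

(** The identity when the blocks do not fit into [n], so that the permutation exists for all
    parameters. *)
Definition block a x y : {perm 'I_n} := perm (@block_ord_inj a x y).

Lemma blockE a x y (k : 'I_n) : block a x y k = block_fun a x y k :> nat.
Proof. by rewrite permE. Qed.

Lemma blockV a x y : (block a x y)^-1%g = block a y x.
Proof.
apply/eqP; rewrite eq_invg_mul; apply/eqP/permP => k; apply: val_inj => /=.
by rewrite permM perm1 !blockE block_funK.
Qed.

Lemma rank_block a x y k l : a + x + y <= n -> k <= n -> l <= n ->
  rank (block a x y) k l =
    minn k (minn l (a + (k - (a + x)) + (l - (a + y)))).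
Proof.
move=> le_n le_k le_l; elim: k le_k => [|k IHk] le_k.
  by rewrite rank0 min0n.
rewrite (rankS _ (Ordinal le_k)) IHk ?(ltnW le_k) // blockE /= /block_fun le_n.
by do !case: ifP; lia.
Qed.

Lemma descents_block a x y : 0 < x -> 0 < y -> a + x + y <= n ->
  #|descents (block a x y)| == 1.
Proof.
move=> x_gt0 y_gt0 le_n; have lt_d : (a + x).-1 < n by lia.
apply/cards1P; exists (Ordinal lt_d); apply/setP => k; rewrite !inE -val_eqE /=.
apply/existsP/eqP => [[j /andP[/eqP eq_j]]|eq_k].
  by rewrite !blockE /block_fun eq_j le_n; do !case: ifP; lia.
have lt_k : k.+1 < n by lia.
exists (Ordinal lt_k); rewrite eqxx !blockE /= /block_fun le_n.
by do !case: ifP; lia.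
Qed.

Lemma block_bigrassmannian a x y : 0 < x -> 0 < y -> a + x + y <= n ->
  block a x y \in bigrassmannian n.
Proof.
by move=> ? ? ?; rewrite inE blockV !descents_block //; lia.
Qed.

(** For the forward direction the cell [(a + x, a + y)] suffices: the rank of [block a x y] there is
    [a], and [b + (a + x - (b + z))^+ + (a + y - (b + t))^+ <= a] amounts to the four
    inequalities. *)
Lemma bruhat_le_block a x y b z t :
  0 < x -> 0 < y -> a + x + y <= n -> 0 < z -> 0 < t -> b + z + t <= n ->
  bruhat_le (block a x y) (block b z t) =
  [&& b <= a, b + z + t >= a + x + y, x <= z & y <= t].
Proof.
move=> ? ? ? ? ? ?; apply/idP/idP => [/bruhat_leP le_r|le_abxyzt].
  by have := le_r (a + x) (a + y); rewrite !rank_block; lia.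
apply/bruhat_leP => k l.
rewrite [rank (block b z t) k l]rank_minn.
rewrite [rank (block a x y) k l]rank_minn.
by rewrite !rank_block ?geq_minr //; lia.
Qed.

(** Within an increasing run, a value below [l] is preceded only by values below [l], which is the
    monotonicity that [concave_steps] needs. *)
Lemma rank_no_descent (w : {perm 'I_n}) l u v k :
  (forall i j : 'I_n, u <= i -> j = i.+1 :> nat -> j < v -> w i < w j) ->
  u <= k <= v -> v <= n ->
  rank w k l = minn (rank w u l + (k - u)) (rank w v l).
Proof.
move=> incr /andP[le_uk le_kv] le_vn.
(* Extended by [false] beyond the positions of [w], as [concave_steps] is indexed by [nat]. *)
pose b i := if insub i is Some j then w j < l else false.
have bE (i : 'I_n) : b i = (w i < l) by rewrite /b valK.
have := @concave_steps (fun i => rank w (u + i) l) (fun i => b (u + i)) (v - u)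
  (k - u).
rewrite !subnKC ?addn0; try lia.
apply=> [i lt_i|i lt_i|]; last by lia.
  have lt_ui : u + i < n by lia.
  by rewrite addnS (rankS _ (Ordinal lt_ui)) -bE.
have lt_ui : u + i < n by lia.
have lt_uSi : u + i.+1 < n by lia.
rewrite (bE (Ordinal lt_ui)) (bE (Ordinal lt_uSi)); apply: ltn_trans.
by apply: incr => /=; lia.
Qed.

(** [d] is the 0-based position just after the descent, that is, the length of the first increasing
    run. *)
Lemma descents1P (w : {perm 'I_n}) : #|descents w| == 1 ->
  exists d : nat, [/\ 0 < d, d < n,
    (forall i j : 'I_n, j = i.+1 :> nat -> j != d :> nat -> w i < w j) &
    (forall i j : 'I_n, j = i.+1 :> nat -> j = d :> nat -> w j < w i)].
Proof.
case/cards1P => d /setP eq_d; have := eq_d d; rewrite !inE eqxx.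
case/existsP => d' /andP[/eqP eq_d' lt_w]; exists d'.
split=> [||i j eq_j ne_j|i j eq_j eq_jd]; first by lia.
- exact: ltn_ord.
- have : i \notin descents w.
    by rewrite eq_d inE -val_eqE /=; lia.
  rewrite inE negb_exists => /forallP/(_ j); rewrite eq_j eqxx /= -leqNgt.
  rewrite leq_eqVlt => /orP[/eqP/val_inj/perm_inj eq_ij|//].
  by move: eq_j; rewrite eq_ij; lia.
- have -> : j = d' by apply: val_inj.
  by have -> : i = d by apply: val_inj => /=; lia.
Qed.

(** The piecewise formula [row], used for [w] and for its inverse, reduces every cell to
    [(d, e)]. *)
Lemma rank_bigrassmannian (w : {perm 'I_n}) d e :
  d <= n -> e <= n ->
  (forall i j : 'I_n, j = i.+1 :> nat -> j != d :> nat -> w i < w j) ->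
  (forall i j : 'I_n, j = i.+1 :> nat -> j != e :> nat -> w^-1%g i < w^-1%g j) ->
  forall k l, k <= n -> l <= n ->
  rank w k l = minn k (minn l (rank w d e + (k - d) + (l - e))).
Proof.
move=> le_d le_e incr incrV.
have row (v : {perm 'I_n}) f : f <= n ->
  (forall i j : 'I_n, j = i.+1 :> nat -> j != f :> nat -> v i < v j) ->
  forall k l, k <= n -> l <= n -> rank v k l =
    if k <= f then minn k (rank v f l) else minn (rank v f l + (k - f)) l.
  move=> le_f inc k l le_k le_l; case: leqP => [le_kf|lt_fk].
    rewrite (@rank_no_descent v l 0 f k) ?rank0 ?subn0 // => i j _ eq_j lt_j.
    by apply: inc => //; lia.
  rewrite (@rank_no_descent v l f n k) ?rank_row_full //; last by lia.
  by move=> i j le_i eq_j lt_j; apply: inc => //; lia.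
move=> k l le_k le_l; have := row w d le_d incr k l le_k le_l.
have := row _ e le_e incrV l d le_l le_d; rewrite -!rankV.
have := row w d le_d incr d e le_d le_e.
have := row _ e le_e incrV e d le_e le_d; rewrite -!rankV !leqnn.
by case: (leqP k d); case: (leqP l e); lia.
Qed.

Lemma bigrassmannianP (w : {perm 'I_n}) : w \in bigrassmannian n ->
  exists a x y, [/\ 0 < x, 0 < y, a + x + y <= n & w = block a x y].
Proof.
rewrite inE => /andP[/descents1P[d [d_gt0 lt_dn incr desc]]].
case/descents1P => e [e_gt0 lt_en incrV descV].
have rankE := rank_bigrassmannian (ltnW lt_dn) (ltnW lt_en) incr incrV.
set a := rank w d e in rankE.
(* From the full row, where [rank w n e = e]. *)
have le_n : d + e <= n + a.
  by have := rankE n e (leqnn n) (ltnW lt_en); rewrite rank_row_full; lia.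
have le_a : a <= minn d e by have := rankE d e; rewrite -/a; lia.
(* Otherwise the rank would be [minn k l], that of the identity, which is concave in [k]; the
   descent at [d] contradicts this. *)
have lt_a : a < minn d e.
  rewrite ltnNge; apply/negP => ge_a.
  have lt_d' : d.-1 < n by lia.
  pose i := Ordinal lt_d'; pose j := Ordinal lt_dn.
  have lt_w : w j < w i by apply: desc => //=; lia.
  have le_wi : w i <= n := ltnW (ltn_ord _).
  have := rankS w i (w i); have := rankS w j (w i).
  by rewrite lt_w ltnn /= prednK // !rankE //; lia.
exists a, (d - a), (e - a); split; try lia.
by apply: rank_inj => k l le_k le_l; rewrite rankE // rank_block; lia.
Qed.

End Block.

(** * Auxiliary finite sums *)

Lemma sum_ord_itv N l u : \sum_(k < N) (l <= k < u) = minn u N - l.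
Proof.
by elim: N => [|N IHN]; rewrite ?big_ord0 ?big_ord_recr ?IHN /=; lia.
Qed.

(** Doubled to avoid division in [nat]; this is the count behind the formula for [beta]. *)
Lemma sum_rect x y :
  (\sum_(q < x) \sum_(r < y) (q + r).+1).*2 = x * y * (x + y).
Proof.
elim: x => [|x IHx]; first by rewrite big_ord0.
rewrite big_ord_recr /= doubleD IHx.
suff -> : (\sum_(r < y) (x + r).+1).*2 = y * (x.*2 + y.+1) by lia.
elim: y {IHx} => [|y IHy]; first by rewrite big_ord0.
by rewrite big_ord_recr /= doubleD IHy; lia.
Qed.

(** Passing from [v] to [v.+1] adds the antidiagonal [q + r = v], with exactly one [r] for each
    [q <= v]. *)
Lemma sum_antidiagonals (V : nmodType) (G : nat -> nat -> V) v N : v <= N ->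
  (\sum_(q < N) \sum_(r < N) (if (q + r < v)%N then G q r else 0) =
   \sum_(t < v) \sum_(q < t.+1) G q (t - q)%N)%R.
Proof.
elim: v => [|v IHv] lt_vN.
  by rewrite big_ord0 big1 // => q _; apply: big1.
rewrite big_ord_recr /= -IHv ?(ltnW lt_vN) //.
rewrite (big_ord_widen N (fun q => G q (v - q)%N)) // [X in (_ + X)%R]big_mkcond.
rewrite -big_split; apply: eq_bigr => q _ /=.
case: ltnP => [lt_qv|le_vq].
  have lt_r : v - q < N by lia.
  rewrite (bigD1 (Ordinal lt_r)) // [in RHS](bigD1 (Ordinal lt_r)) //=.
  have -> : q + (v - q) < v.+1 by lia.
  have -> : (q + (v - q) < v) = false by lia.
  rewrite add0r addrC; congr (_ + _)%R; apply: eq_bigr => r.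
  by rewrite -val_eqE /= => ne_r; congr (if _ then _ else _); lia.
by rewrite addr0; apply: eq_bigr => r _; congr (if _ then _ else _); lia.
Qed.

(** * Bigrassmannian permutations as lattice points of a simplex *)

Section Simplex.

Variable m : nat.

Notation triple := ('I_m.+1 * 'I_m.+1 * 'I_m.+1)%type.
Implicit Types t u : triple.

(** A triple is [(p, q, r)]; the fourth coordinate [s = m - p - q - r] stays implicit. *)
Definition simplex : {set triple} := [set t : triple | t.1.1 + t.1.2 + t.2 <= m].

(** The shifts by one make both exchanged blocks nonempty. *)
Definition simplex_block t := block m.+2 t.1.1 t.1.2.+1 t.2.+1.

(* In terms of the barycentric coordinates [p + q + r + s = m]: [p] and [s]
   decrease while [q] and [r] increase. *)
Definition simplex_le t u :=
  [&& u.1.1 <= t.1.1, t.1.1 + t.1.2 + t.2 <= u.1.1 + u.1.2 + u.2,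
      t.1.2 <= u.1.2 & t.2 <= u.2].

(* The order-reversing exchange of [p] with [q] and of [r] with [s]. *)
Definition simplex_swap t : triple :=
  (t.1.2, t.1.1, sub_ord (t.1.1 + t.1.2 + t.2)).

Lemma bruhat_le_simplex t u : t \in simplex -> u \in simplex ->
  bruhat_le (simplex_block t) (simplex_block u) = simplex_le t u.
Proof.
rewrite !inE => tP uP; rewrite bruhat_le_block //; try lia.
by rewrite /simplex_le; lia.
Qed.

Lemma simplex_le_anti t u : simplex_le t u -> simplex_le u t -> t = u.
Proof.
case: t u => [[p q] r] [[p' q'] r'] /and4P[/= ? ? ? ?] /and4P[/= ? ? ? ?].
by congr (_, _, _); apply: val_inj => /=; lia.
Qed.

(** Triples with equal images are comparable in both directions, hence equal by antisymmetry. *)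
Lemma simplex_block_inj : {in simplex &, injective simplex_block}.
Proof.
move=> t u tP uP eq_tu; apply: simplex_le_anti.
  by rewrite -bruhat_le_simplex // eq_tu; apply: connect0.
by rewrite -bruhat_le_simplex // eq_tu; apply: connect0.
Qed.

Lemma bigrassmannianE : bigrassmannian m.+2 = simplex_block @: simplex.
Proof.
apply/setP => w; apply/idP/imsetP => [/bigrassmannianP|[t]].
  case=> a [x [y [x_gt0 y_gt0 le_m ->]]].
  exists (inord a, inord x.-1, inord y.-1).
    by rewrite inE /= !inordK; lia.
  by rewrite /simplex_block /= !inordK ?prednK //; lia.
by rewrite inE => tP ->; apply: block_bigrassmannian; lia.
Qed.

Lemma sum_bigrassmannian (V : nmodType) (F : {perm 'I_m.+2} -> V) :
  (\sum_(w in bigrassmannian m.+2) F w = \sum_(t in simplex) F (simplex_block t))%R.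
Proof.
by rewrite bigrassmannianE big_imset //; apply: simplex_block_inj.
Qed.

Lemma card_bigrassmannian_in (P : pred {perm 'I_m.+2}) (Q : pred triple) :
  {in simplex, forall t, P (simplex_block t) = Q t} ->
  #|[set w in bigrassmannian m.+2 | P w]| = #|[set t in simplex | Q t]|.
Proof.
move=> PQ; rewrite -(card_in_imset (f := simplex_block)); last first.
  move=> u v; rewrite inE => /andP[uP _]; rewrite inE => /andP[vP _].
  exact: simplex_block_inj.
rewrite bigrassmannianE; apply: eq_card => w; rewrite inE.
apply/andP/imsetP => [[/imsetP[t tP ->]]|[t]].
  by rewrite PQ // => Qt; exists t => //; rewrite inE tP.
by rewrite inE => /andP[tP Qt] ->; rewrite PQ // Qt; split=> //; apply: imset_f.
Qed.

Lemma bruhat_beta_simplex t : t \in simplex ->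
  bruhat_beta (simplex_block t) = #|[set u in simplex | simplex_le u t]|.
Proof.
by move=> tP; apply: card_bigrassmannian_in => u uP; apply: bruhat_le_simplex.
Qed.

Lemma bruhat_alpha_simplex t : t \in simplex ->
  bruhat_alpha (simplex_block t) = #|[set u in simplex | simplex_le t u]|.
Proof.
by move=> tP; apply: card_bigrassmannian_in => u uP; apply: bruhat_le_simplex.
Qed.

Lemma simplex_swap_in t : t \in simplex -> simplex_swap t \in simplex.
Proof. by rewrite !inE /=; lia. Qed.

Lemma simplex_swapK : {in simplex, involutive simplex_swap}.
Proof.
move=> [[p q] r]; rewrite inE /= => le_m.
by congr (_, _, _); apply: val_inj => /=; lia.
Qed.

Lemma simplex_le_swap t u : t \in simplex -> u \in simplex ->
  simplex_le (simplex_swap t) (simplex_swap u) = simplex_le u t.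
Proof. by rewrite !inE /simplex_le /=; lia. Qed.

(** As an order-reversing involution, the swap maps the up-set of [t] onto the down-set of
    [simplex_swap t]. *)
Lemma bruhat_alpha_swap t : t \in simplex ->
  bruhat_alpha (simplex_block t) = bruhat_beta (simplex_block (simplex_swap t)).
Proof.
move=> tP; rewrite bruhat_alpha_simplex // bruhat_beta_simplex ?simplex_swap_in //.
rewrite -(card_in_imset (f := simplex_swap)); last first.
  move=> u v; rewrite !inE => /andP[? _] /andP[? _] eq_uv.
  by rewrite -(simplex_swapK (x := u)) ?inE // eq_uv simplex_swapK ?inE.
congr #|pred_of_set _|; apply/setP => u.
apply/imsetP/idP => [[v]|].
  rewrite inE => /andP[vP le_tv] ->.
  by rewrite inE simplex_swap_in // simplex_le_swap.
rewrite inE => /andP[uP le_ut]; exists (simplex_swap u); last by rewrite simplex_swapK.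
rewrite inE simplex_swap_in //= -simplex_le_swap ?simplex_swap_in //.
by rewrite simplex_swapK.
Qed.

(** By the swap the two statistics are equidistributed, which settles all moments at once. *)
Lemma sum_alpha_beta (V : nmodType) (F : nat -> V) :
  (\sum_(w in bigrassmannian m.+2) F (bruhat_alpha w) =
   \sum_(w in bigrassmannian m.+2) F (bruhat_beta w))%R.
Proof.
rewrite !sum_bigrassmannian.
rewrite [RHS](reindex_onto simplex_swap simplex_swap) /=; last exact: simplex_swapK.
apply: eq_big => [t|t tP]; last by rewrite bruhat_alpha_swap.
apply/idP/andP => [tP|[tP /eqP <-]]; last exact: simplex_swap_in.
by rewrite simplex_swap_in ?simplex_swapK.
Qed.

Lemma big_triple (R : Type) (idx : R) (op : Monoid.com_law idx) (F : triple -> R) :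
  \big[op/idx]_t F t = \big[op/idx]_p \big[op/idx]_q \big[op/idx]_r F (p, q, r).
Proof.
rewrite pair_bigA pair_bigA /=.
by apply: eq_bigr => -[[]].
Qed.

Lemma card_simplex_le t : t \in simplex ->
  (#|[set u in simplex | simplex_le u t]|).*2 =
    t.1.2.+1 * t.2.+1 * (t.1.2.+1 + t.2.+1).
Proof.
case: t => [[p q] r]; rewrite inE /= => le_m; rewrite -sum_rect; congr _.*2.
transitivity (\sum_(u : triple) (u \in simplex) && simplex_le u (p, q, r)).
  by rewrite -sum1_card big_mkcond; apply: eq_bigr => u _; rewrite inE; case: ifP.
rewrite big_triple exchange_big [RHS](reindex_inj rev_ord_inj) /=.
rewrite (big_ord_widen m.+1 (fun q' => \sum_(r' < r.+1) (q.+1 - q'.+1 + r').+1)) //.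
rewrite [RHS]big_mkcond; apply: eq_bigr => q' _.
case: ltnP => le_q'q; last first.
  by apply: big1 => p' _; apply: big1 => r' _; rewrite inE /simplex_le /=; lia.
rewrite exchange_big [RHS](reindex_inj rev_ord_inj) /=.
rewrite (big_ord_widen m.+1 (fun r' => (q.+1 - q'.+1 + (r.+1 - r'.+1)).+1)) //.
rewrite [RHS]big_mkcond; apply: eq_bigr => r' _.
(* For fixed [q' <= q] and [r'], the admissible [p'] satisfy [p <= p' < e]; the value [e = p] makes
   this range empty when [r' > r]. *)
pose e := if r' < r.+1 then p + (q - q' + (r - r')).+1 else p : nat.
transitivity (\sum_(p' < m.+1) (p <= p' < e)).
  apply: eq_bigr => p' _; rewrite inE /simplex_le /e /=; congr nat_of_bool.
  by case: ifP; lia.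
by rewrite sum_ord_itv /e; case: ifP; lia.
Qed.

(* The slice at fixed [p] is a triangle, summed along its antidiagonals. *)
Lemma sum_simplex (V : nmodType) (G : nat -> nat -> V) :
  (\sum_(t in simplex) G t.1.2 t.2 =
   \sum_(u < m.+1) \sum_(t < u.+1) \sum_(q < t.+1) G q (t - q)%N)%R.
Proof.
rewrite big_mkcond big_triple (reindex_inj rev_ord_inj) /=; apply: eq_bigr => u _.
rewrite -(@sum_antidiagonals _ _ u.+1 m.+1) //.
apply: eq_bigr => q _; apply: eq_bigr => r _; rewrite inE /=.
by congr (if _ then _ else _); have := ltn_ord u; lia.
Qed.

End Simplex.

(** * First and second moments in closed form *)

Local Open Scope ring_scope.

(** Discrete integration: the closed forms below are supplied as antidifferences and verified by
    [field]. *)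
Lemma telescope_sum (V : zmodType) (f F : nat -> V) k :
  F 0 = 0 -> (forall i, F i.+1 = F i + f i) -> \sum_(i < k) f i = F k.
Proof.
move=> F0 FS; elim: k => [|k IHk]; first by rewrite big_ord0 F0.
by rewrite big_ord_recr /= IHk FS.
Qed.

Definition beta_value q r : rat :=
  (q%:R + 1) * (r%:R + 1) * (q%:R + r%:R + 2) / 2.

Section Moments.

Variable m : nat.

Local Notation B := (bigrassmannian m.+2).
Local Notation M := (m%:R : rat).

Lemma sum_beta (F : rat -> rat) :
  \sum_(w in B) F (bruhat_beta w)%:R =
  \sum_(u < m.+1) \sum_(t < u.+1) \sum_(q < t.+1) F (beta_value q (t - q)%N).
Proof.
rewrite -(@sum_simplex m _ (fun q r => F (beta_value q r))) sum_bigrassmannian.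
apply: eq_bigr => t tP; congr F; rewrite bruhat_beta_simplex //.
apply: (mulIf (_ : 2 != 0 :> rat)) => //; rewrite divfK // mulr_natr -mulrnA muln2.
by rewrite card_simplex_le // !natrM natrD -!natr1; ring.
Qed.

(** [f2] and [f3] are successive antidifferences; the shift in [f2 k.+1] reflects that the middle
    sum has [u.+1] terms. *)
Lemma sum_beta_closed (F : rat -> rat) (f1 f2 f3 : nat -> rat) :
  (forall t, \sum_(q < t.+1) F (beta_value q (t - q)%N) = f1 t) ->
  f2 0 = 0 -> (forall k, f2 k.+1 = f2 k + f1 k) ->
  f3 0 = 0 -> (forall k, f3 k.+1 = f3 k + f2 k.+1) ->
  \sum_(w in B) F (bruhat_beta w)%:R = f3 m.+1.
Proof.
move=> sum1 f20 f2S f30 f3S.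
rewrite sum_beta -(telescope_sum _ f30 f3S); apply: eq_bigr => u _.
by rewrite -(telescope_sum _ f20 f2S); apply: eq_bigr => t _; rewrite sum1.
Qed.

Lemma card_bigrassmannian_rat :
  #|B|%:R = (M + 1) * (M + 2) * (M + 3) / 6 :> rat.
Proof.
rewrite -sum1_card natr_sum (@sum_beta_closed (fun=> 1) (fun t => t%:R + 1)
  (fun k => k%:R * (k%:R + 1) / 2)
  (fun k => k%:R * (k%:R + 1) * (k%:R + 2) / 6)).
- by rewrite -natr1; field.
- by move=> t; rewrite sumr_const card_ord natr1.
- by field.
- by move=> k; rewrite -natr1; field.
- by field.
- by move=> k; rewrite -natr1; field.
Qed.

Lemma sum_antidiag_beta t : \sum_(q < t.+1) beta_value q (t - q)%N =
  (t%:R + 1) * (t%:R + 2) ^+ 2 * (t%:R + 3) / 12.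
Proof.
transitivity (\sum_(q < t.+1)
    (q%:R + 1) * (t%:R - q%:R + 1) * (t%:R + 2) / 2 : rat).
  apply: eq_bigr => q _; rewrite /beta_value natrB; last by rewrite -ltnS.
  by field.
(* With [j = q + 1], the product [(q + 1) * (t - q + 1)] is [(t + 2) * j - j ^ 2], summed by the
   formulas for the powers 1 and 2. *)
rewrite (telescope_sum (f := fun q => (q%:R + 1) * (t%:R - q%:R + 1) *
    (t%:R + 2) / 2) (F := fun k => (t%:R + 2) / 2 *
  ((t%:R + 2) * (k%:R * (k%:R + 1) / 2) -
   k%:R * (k%:R + 1) * (2 * k%:R + 1) / 6))) => [||k]; rewrite -?natr1; by field.
Qed.

Lemma sum_antidiag_beta_sqr t : \sum_(q < t.+1) beta_value q (t - q)%N ^+ 2 =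
  (t%:R + 1) * (t%:R + 2) ^+ 3 * (t%:R + 3) * (t%:R ^+ 2 + 4 * t%:R + 5) / 120.
Proof.
transitivity (\sum_(q < t.+1)
    ((q%:R + 1) * (t%:R - q%:R + 1) * (t%:R + 2) / 2) ^+ 2 : rat).
  apply: eq_bigr => q _; rewrite /beta_value natrB; last by rewrite -ltnS.
  by congr (_ ^+ 2); field.
(* Faulhaber's formulas for the powers 2, 3 and 4 *)
rewrite (telescope_sum (f := fun q => ((q%:R + 1) * (t%:R - q%:R + 1) *
    (t%:R + 2) / 2) ^+ 2) (F := fun k => (t%:R + 2) ^+ 2 / 4 *
  ((t%:R + 2) ^+ 2 * (k%:R * (k%:R + 1) * (2 * k%:R + 1) / 6) -
   2 * (t%:R + 2) * (k%:R * (k%:R + 1) / 2) ^+ 2 +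
   k%:R * (k%:R + 1) * (2 * k%:R + 1) * (3 * k%:R ^+ 2 + 3 * k%:R - 1) / 30)))
  => [||k]; rewrite -?natr1; by field.
Qed.

Lemma sum_beta1 : \sum_(w in B) (bruhat_beta w)%:R =
  (M + 1) * (M + 2) * (M + 3) ^+ 2 * (M + 4) * (M + 5) / 360 :> rat.
Proof.
rewrite (@sum_beta_closed id _
  (fun k => k%:R * (k%:R + 1) * (k%:R + 2) * (k%:R + 3) * (2 * k%:R + 3) / 120)
  (fun k => k%:R * (k%:R + 1) * (k%:R + 2) ^+ 2 * (k%:R + 3) * (k%:R + 4) / 360)
  sum_antidiag_beta).
- by rewrite -natr1; field.
- by field.
- by move=> k; rewrite -natr1; field.
- by field.
- by move=> k; rewrite -natr1; field.
Qed.

Lemma sum_beta2 : \sum_(w in B) (bruhat_beta w)%:R ^+ 2 =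
  (M + 1) * (M + 2) ^+ 2 * (M + 3) ^+ 3 * (M + 4) ^+ 2 * (M + 5) / 8640 :> rat.
Proof.
rewrite (@sum_beta_closed (fun x => x ^+ 2) _
  (fun k => k%:R * (k%:R + 1) ^+ 2 * (k%:R + 2) ^+ 2 * (k%:R + 3) *
     (3 * k%:R ^+ 2 + 9 * k%:R + 8) / 2880)
  (fun k => k%:R * (k%:R + 1) ^+ 2 * (k%:R + 2) ^+ 3 * (k%:R + 3) ^+ 2 *
     (k%:R + 4) / 8640) sum_antidiag_beta_sqr).
- by rewrite -natr1; field.
- by field.
- by move=> k; rewrite -natr1; field.
- by field.
- by move=> k; rewrite -natr1; field.
Qed.

End Moments.

(** * Variance and conclusion *)

Lemma uvarianceE (T : finType) (A : {set T}) (f : T -> rat) : A != set0 ->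
  uvariance A f = uexpectation A (fun x => f x ^+ 2) - uexpectation A f ^+ 2.
Proof.
move=> A_neq0; rewrite {1}/uvariance; set e := uexpectation A f.
have card_neq0 : #|A|%:R != 0 :> rat by rewrite pnatr_eq0 cards_eq0.
have sum_f : \sum_(x in A) f x = e * #|A|%:R by rewrite divfK.
rewrite {1 2}/uexpectation (eq_bigr (fun x => f x ^+ 2 - 2 * e * f x + e ^+ 2)).
  by rewrite big_split sumrB -mulr_sumr sum_f sumr_const -mulr_natr /=; field.
by move=> x _; ring.
Qed.

Theorem theorem4p1 (n : nat) (hn : (2 <= n)%N) :
  let B := bigrassmannian n in
  let alpha := fun w : {perm 'I_n} => (bruhat_alpha w)%:R : rat in
  let beta := fun w : {perm 'I_n} => (bruhat_beta w)%:R : rat in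
  let N : rat := n%:R in
  [/\ uexpectation B alpha = uexpectation B beta,
      uexpectation B beta = (N + 3) * (N + 2) * (N + 1) / 60
    & (N + 3) * (N + 2) * (N + 1) / 60 = #|bigrassmannian n.+2|%:R / 10] /\
  [/\ uvariance B alpha = uvariance B beta,
      uvariance B beta =
        (N + 3) * (N + 2) ^+ 2 * (N + 1) ^+ 2 * (N - 2) / 2400
    & (N + 3) * (N + 2) ^+ 2 * (N + 1) ^+ 2 * (N - 2) / 2400 =
        3 * (N - 2) * uexpectation B alpha ^+ 2 / (2 * (N + 3))].
Proof.
have [m eq_n] : exists m, n = m.+2 by exists n.-2; lia.
move: hn; rewrite eq_n => _ B alpha beta N {n eq_n}.
have N_E : N = m%:R + 2 by rewrite /N -!natr1; ring.
have m_ge0 : 0 <= m%:R :> rat by rewrite ler0n.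
(* An arbitrary [F] covers both the mean and, after centring, the variance. *)
have eq_alpha (F : rat -> rat) : uexpectation B (fun w => F (alpha w)) =
    uexpectation B (fun w => F (beta w)).
  by rewrite /uexpectation (sum_alpha_beta _ (fun k => F k%:R)).
have E_beta : uexpectation B beta = (N + 3) * (N + 2) * (N + 1) / 60.
  rewrite /uexpectation sum_beta1 card_bigrassmannian_rat N_E; field.
  by rewrite !lt0r_neq0 //; lra.
have E_alpha : uexpectation B alpha = (N + 3) * (N + 2) * (N + 1) / 60.
  by rewrite (eq_alpha id).
have B_neq0 : B != set0.
  rewrite -cards_eq0 -(pnatr_eq0 rat) card_bigrassmannian_rat.
  by rewrite lt0r_neq0 // divr_gt0 // !mulr_gt0 //; lra.
split; split.
- exact: (eq_alpha id).
- exact: E_beta.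
(* The cardinality formula is taken here at [m.+2] instead of [m]. *)
- by rewrite card_bigrassmannian_rat -!natr1 N_E; field.
- by rewrite /uvariance E_alpha E_beta (eq_alpha (fun x => (x - _) ^+ 2)).
- rewrite (uvarianceE _ B_neq0) E_beta /uexpectation sum_beta2 card_bigrassmannian_rat N_E.
  field; by rewrite !lt0r_neq0 //; lra.
- rewrite E_alpha N_E; field; by rewrite !lt0r_neq0 //; lra.
Qed.
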